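(* If the detection function $d$ is regular and $\lim_{y\to\infty}d(x,y)=1$ for all $x\in X$, the target distribution is continuous with a probability density function $\pi$, the true target location $x_0$ belongs to the support of the target distribution, and the cumulative effort function $E$ satisfies $\lim_{t\to\infty}E(t)=\infty$, then the uniformly optimal search plan $\varphi^\star$ for the target distribution within $\Phi(E)$ satisfies $$\lim_{t\to\infty}P^{\#}[\varphi^\star(\cdot,t)]=1.$$
   Context: Notation: $\mathbb{R}_+=[0,\infty)$. One searches for a stationary target whose exact location is unknown; $x_0$ denotes its true location. The uncertainty about the location is described by a non-degenerate probability distribution, the target distribution, with density function $\pi$. The possibility area $X\subseteq\mathbb{R}^n$ ($n$ a positive integer) is the support of the target distribution. In the continuous case considered here, $X$ is uncountable and search effort is allocated continuously. An allocation on $X$ is a function $f:X\to\mathbb{R}_+$ such that $\int_A f(x)\,dx$ is the amount of search effort allocated in $A$, for $A\subseteq X$. The cost of an allocation $f$ is $\int_X f(x)\,dx$, i.e. the cost density of applying effort density $y$ at $x$ is $c(x,y)=y$. A detection function is a function $d:X\times\mathbb{R}_+\to[0,1]$, where $d(x,y)$ is the conditional probability of detecting the target if the effort density at $x$ equals $y$, given that the target is at $x$. It is regular if $d(x,0)=0$ and $\partial d(x,y)/\partial y$ is continuous, positive, and strictly decreasing (as a function of $y$) for all $x\in X$. For an allocation $f$, the subjective probability of detection is $P[f]=\int_X d(x,f(x))\pi(x)\,dx$, and the true probability of detection is $P^{\#}[f]=d(x_0,f(x_0))$. A search plan on $X$ is a function $\varphi:X\times\mathbb{R}_+\to\mathbb{R}_+$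 such that $\varphi(\cdot,t)$ is an allocation on $X$ for all $t\ge0$ and $\varphi(x,\cdot)$ is an increasing function for all $x\in X$. The cumulative effort function $E$ is a non-negative increasing function on $\mathbb{R}_+$ with $E(t)>0$ for all $t>0$; $E(t)$ is the effort available by time $t$. $\Phi(E)$ is the class of search plans $\varphi$ such that $\int_X\varphi(x,t)\,dx=E(t)$ for all $t\ge0$. A search plan $\varphi^\star\in\Phi(E)$ is uniformly optimal for the target distribution within $\Phi(E)$ if $P[\varphi^\star(\cdot,t)]=\max\{P[\varphi(\cdot,t)]:\varphi\in\Phi(E)\}$ for all $t\ge0$.
   Formalization: Support is read as the set where the density is positive; the limit is proved for almost every such x_0 for any uniformly optimal plan, and for every such x_0 when the plan satisfies the Lagrange multiplier rule at every point, since optimality ignores null sets. *)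

(* Defs.v *)
From HB Require Import structures.
From mathcomp Require Import all_boot all_order all_algebra.
From mathcomp Require Import all_classical all_reals all_analysis.

Set Implicit Arguments.
Unset Strict Implicit.
Unset Printing Implicit Defensive.

Import Order.TTheory GRing.Theory Num.Theory.
Import numFieldNormedType.Exports.

Local Open Scope classical_set_scope.
Local Open Scope ring_scope.

(* Points of R^n are n-tuples, measurable for the product of the Borel
   sigma-algebras of the coordinates. *)
Notation euclidean R n := (n.-tuple (measurableTypeR R)).

Section lebesgue_step.
Context (R : realType) (n : nat).
Variable m : {sigma_finite_measure set (euclidean R n) -> \bar R}.

Definition tuple_of_pair (p : measurableTypeR R * euclidean R n) :
  euclidean R n.+1 := [tuple of p.1 :: p.2].

Lemma measurable_tuple_of_pair : measurable_fun setT tuple_of_pair.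
Proof. exact: measurable_cons. Qed.

Definition lebesgue_step : set (euclidean R n.+1) -> \bar R :=
  pushforward (lebesgue_measure \x m)%E tuple_of_pair.

Let lebesgue_step0 : lebesgue_step set0 = 0%E.
Proof. by rewrite /lebesgue_step /pushforward preimage_set0 measure0. Qed.

Let lebesgue_step_ge0 A : (0 <= lebesgue_step A)%E.
Proof. by rewrite /lebesgue_step /pushforward measure_ge0. Qed.

Let lebesgue_step_sigma_additive : semi_sigma_additive lebesgue_step.
Proof.
have mf k (F : (set (euclidean R n.+1))^nat) : measurable (F k) ->
    measurable (tuple_of_pair @^-1` F k).
  by move=> mF; rewrite -[X in measurable X]setTI;
    exact: measurable_tuple_of_pair.
move=> F mF tF mUF; rewrite /lebesgue_step /pushforward preimage_bigcup.
apply: measure_semi_sigma_additive.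
- by move=> k; exact: mf.
- apply/trivIsetP => /= i j _ _ ij; rewrite -preimage_setI.
  by move/trivIsetP : tF => /(_ _ _ _ _ ij) ->//; rewrite preimage_set0.
- rewrite -preimage_bigcup -[X in measurable X]setTI.
  exact: measurable_tuple_of_pair.
Qed.

HB.instance Definition _ := isMeasure.Build _ _ _ lebesgue_step
  lebesgue_step0 lebesgue_step_ge0 lebesgue_step_sigma_additive.

Let lebesgue_step_sigma_finite : sigma_finite setT lebesgue_step.
Proof.
have /sigma_finiteP[F [TF ndF Foo]] :=
  sigma_finiteT (@lebesgue_measure R).
have /sigma_finiteP[G [TG ndG Goo]] := sigma_finiteT m.
pose hd (t : euclidean R n.+1) : measurableTypeR R := tnth t ord0.
pose tl (t : euclidean R n.+1) : euclidean R n := [tuple of behead t].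
exists (fun k => hd @^-1` F k `&` tl @^-1` G k).
  rewrite predeqE => t; split=> // _.
  have [i _ Fi] : (\bigcup_i F i) (hd t) by rewrite -TF.
  have [j _ Gj] : (\bigcup_j G j) (tl t) by rewrite -TG.
  exists (maxn i j) => //; split=> /=.
  - by move: Fi; exact/subsetPset/ndF/leq_maxl.
  - by move: Gj; exact/subsetPset/ndG/leq_maxr.
move=> k; have [mFk Fkoo] := Foo k; have [mGk Gkoo] := Goo k; split.
  apply: measurableI; rewrite -[X in measurable X]setTI.
  - exact: measurable_tnth.
  - exact: measurable_behead.
rewrite /lebesgue_step /pushforward.
rewrite (_ : _ @^-1` _ = F k `*` G k).
  by rewrite product_measure1E// lte_mul_pinfty// ge0_fin_numE.
rewrite predeqE => -[x t]; rewrite /hd /tl /tuple_of_pair /=.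
by rewrite (_ : [tuple of _] = t) //; apply: val_inj.
Qed.

HB.instance Definition _ := Measure_isSigmaFinite.Build _ _ _ lebesgue_step
  lebesgue_step_sigma_finite.

End lebesgue_step.

Section lebesgue0.
Context (R : realType).
Definition lebesgue0 : set (euclidean R 0) -> \bar R := \d_([tuple]).
HB.instance Definition _ := Measure.on lebesgue0.

Let lebesgue0_sigma_finite : sigma_finite setT lebesgue0.
Proof.
apply: fin_num_fun_sigma_finite; first by rewrite measure0.
by move=> A mA; exact: fin_num_measure.
Qed.

HB.instance Definition _ := Measure_isSigmaFinite.Build _ _ _ lebesgue0
  lebesgue0_sigma_finite.
End lebesgue0.

(* n-dimensional Lebesgue measure: the n-fold product of lebesgue_measure. *)
Fixpoint lebesgue_n (R : realType) (n : nat) :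
    {sigma_finite_measure set (euclidean R n) -> \bar R} :=
  match n with
  | 0 => @lebesgue0 R
  | n'.+1 => lebesgue_step (lebesgue_n R n')
  end.

Lemma lebesgue_n_box (R : realType) (n : nat)
    (A : 'I_n -> set (measurableTypeR R)) :
  (forall i, measurable (A i)) ->
  lebesgue_n R n [set x | forall i, A i (tnth x i)] =
  (\prod_(i < n) lebesgue_measure (A i))%E.
Proof.
elim: n A => [|n IHn] A mA.
  rewrite big_ord0 /= /lebesgue0 diracE mem_set//.
  by move=> -[].
rewrite big_ord_recl -(IHn (fun i => A (lift ord0 i)))//=.
rewrite /lebesgue_step /pushforward -product_measure1E//; last first.
  rewrite (_ : [set _ | _] =
    \bigcap_(i in [set: 'I_n]) ((@tnth _ _)^~ i @^-1` A (lift ord0 i))).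
    apply: fin_bigcap_measurable => // i _.
    by rewrite -[X in measurable X]setTI; exact: measurable_tnth.
  by rewrite predeqE => x; split=> [h i _|h i]; exact: h.
congr product_measure1; rewrite predeqE => -[x t] /=; split.
  move=> h; split=> [|i]; first exact: (h ord0).
  by have := h (lift ord0 i); rewrite tnthS.
by move=> [Ax At] i; case: (unliftP ord0 i) => [j|] ->; rewrite ?tnthS.
Qed.

Section search.
Context (R : realType) (n : nat).
Let T := euclidean R n.
Let mu := lebesgue_n R n.
Implicit Types (X : set T) (pi : T -> R) (d : T -> R -> R) (E : R -> R).
Implicit Types (f : T -> R) (phi : T -> R -> R).

Definition target_density pi :=
  [/\ measurable_fun setT pi, (forall x, 0 <= pi x)
    & (\int[mu]_x (pi x)%:E = 1)%E].

(* The possibility area X is the support of the density as a function, not its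
   topological closure: at a boundary point with zero density no effort is ever
   worth allocating. *)
Definition possibility_area pi : set T := [set x | 0 < pi x].

(* Functions whose mathematical domain is X, or X x [0, +oo[, are total here;
   their values outside that domain are unconstrained and never used. *)
Definition detection_function X d :=
  forall y, 0 <= y ->
    measurable_fun X (d ^~ y) /\ (forall x, X x -> 0 <= d x y <= 1).

(* The derivative of g at y relative to [0, +oo[; it is one-sided at 0. *)
Definition is_derive_ge0 (g : R -> R) (y l : R) :=
  h^-1 * (g (y + h) - g y)
    @[h --> within [set h | 0 <= y + h] (0 : R)^'] --> l.

Definition regular X d := forall x, X x ->
  d x 0 = 0 /\
  exists d' : R -> R,
    [/\ forall y, 0 <= y -> is_derive_ge0 (d x) y (d' y),
        {within `[0, +oo[, continuous d'},
        forall y, 0 <= y -> 0 < d' y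
      & forall y z, 0 <= y -> y < z -> d' z < d' y].

Definition allocation X f :=
  measurable_fun X f /\ (forall x, X x -> 0 <= f x).

Definition cost X f : \bar R := (\int[mu]_(x in X) (f x)%:E)%E.

Definition detection_prob X d pi f : \bar R :=
  (\int[mu]_(x in X) (d x (f x) * pi x)%:E)%E.

Definition true_detection_prob d (x0 : T) f : R := d x0 (f x0).

Definition search_plan X phi :=
  (forall t, 0 <= t -> allocation X (phi ^~ t)) /\
  (forall x, X x -> forall s t, 0 <= s -> s <= t -> phi x s <= phi x t).

Definition cumulative_effort E :=
  [/\ forall t, 0 <= t -> 0 <= E t,
      forall s t, 0 <= s -> s <= t -> E s <= E t
    & forall t, 0 < t -> 0 < E t].

Definition plan_class X E : set (T -> R -> R) :=
  [set phi | search_plan X phi /\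
    forall t, 0 <= t -> cost X (phi ^~ t) = (E t)%:E].

Definition uniformly_optimal X d pi E phi :=
  plan_class X E phi /\
  forall t, 0 <= t -> forall psi, plan_class X E psi ->
    (detection_prob X d pi (psi ^~ t) <= detection_prob X d pi (phi ^~ t))%E.

(* Uniform optimality determines phi (., t) only up to Lebesgue-null sets, so by
   itself it says nothing about phi (x0, t) at a single point x0. This predicate
   singles out the representative given by the Lagrange multiplier rule at every
   point of X, where optimality alone gives that rule at almost every point. *)
Definition pointwise_representative X d pi phi :=
  forall t, 0 < t -> exists lambda : R, forall x, X x -> forall y, 0 <= y ->
    d x y * pi x - lambda * y <= d x (phi x t) * pi x - lambda * phi x t.

End search.

(* Main.v *)
Require Import Defs.
From mathcomp Require Import all_boot all_order all_algebra.
From mathcomp Require Import all_classical all_reals all_analysis.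
From mathcomp Require Import measurable_realfun.

Set Implicit Arguments.
Unset Strict Implicit.

Import Order.TTheory GRing.Theory Num.Theory.
Import numFieldNormedType.Exports.

Local Open Scope classical_set_scope.
Local Open Scope ring_scope.

(** Almost everywhere: the plan phi is compared with the proportional plan
    psi(x,t) = E(t) pi(x), which lies in Phi(E) because pi integrates to 1 over
    X. For every x in X the effort E(t) pi(x) tends to infinity, so
    d(x, E(t) pi(x)) tends to 1 and, by dominated convergence, P[psi(.,t)] tends
    to 1 ([detection_prob_proportional]). Optimality gives
    P[psi(.,t)] <= P[phi(.,t)] <= 1, hence P[phi(.,t)] tends to 1 as well. Since
    d(x,.) and phi(x,.) are nondecreasing, d(x,phi(x,k)) increases with the
    integer k to some L(x) <= 1, and the integral of (1 - L) pi vanishes; as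
    pi > 0 on X, L = 1 almost everywhere on X ([ae_cvg1_integral]), and
    monotonicity in t replaces integer times by real ones.

    At every point: let lambda be the multiplier at time t, so that phi(x,t)
    maximizes y |-> d(x,y) pi(x) - lambda y for all x in X. Letting y grow shows
    lambda >= 0 ([multiplier_ge0]). Taking y = 0 gives
    lambda phi(x,t) <= d(x,phi(x,t)) pi(x) <= pi(x), and integrating over X gives
    lambda E(t) <= 1 ([multiplier_le]), so lambda tends to 0 as t grows. For a
    fixed y, the maximality of phi(x0,t) then bounds d(x0,phi(x0,t)) from below
    by d(x0,y) - lambda y / pi(x0), whose limit d(x0,y) is as close to 1 as
    desired. *)

(** * One-sided derivatives *)

(** Away from the endpoint 0, the derivative relative to [0, +oo[ is the usual
    two-sided one. *)
Lemma is_derive_ge0_derivable (R : realType) (g : R -> R) (y l : R) :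
  0 < y -> is_derive_ge0 g y l -> derivable g y 1 /\ g^`()%classic y = l.
Proof.
move=> y0 gl.
have nearA : \forall h \near (0 : R)^', 0 <= y + h.
  apply: nbhs_dnbhs; exists y => //= h; rewrite /ball/= sub0r normrN => hy.
  by rewrite -lerBlDl sub0r; have := ltW hy; rewrite ler_norml => /andP[].
have {}gl : h^-1 *: ((g \o shift y) (h *: 1) - g y) @[h --> 0^'] --> l.
  move=> P /gl; rewrite /= !nbhs_filterE /= /within/= => Pl.
  apply: filterS2 Pl nearA => h + yh => /(_ yh) /=.
  by rewrite /shift/= [_%:A]mulr1 (addrC h).
have dg : derivable g y 1 by apply/cvg_ex; exists l.
by split => //; rewrite derive1E; apply: cvg_lim gl.
Qed.

(** * Measurability and convergence *)

(** A Caratheodory-type statement. Monotonicity allows the superlevel sets of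
    x |-> g x (f x) to be written with rational second arguments below f x; the
    points where f vanishes are accounted for by g x 0, so continuity at 0 is
    not needed. *)
Lemma measurable_fun_comp_nondecreasing (d : measure_display)
    (T : measurableType d) (R : realType) (D : set T) (g : T -> R -> R)
    (f : T -> R) :
  (forall y, 0 <= y -> measurable_fun D (g ^~ y)) ->
  (forall x, D x -> forall y z, 0 <= y -> y <= z -> g x y <= g x z) ->
  (forall x, D x -> forall y, 0 < y -> {for y, continuous (g x)}) ->
  measurable_fun D f -> (forall x, D x -> 0 <= f x) ->
  measurable_fun D (fun x => g x (f x)).
Proof.
move=> mg ndg cg mf f0 mD.
apply: (measurability _ (RGenOInfty.measurableE R)) => //.
move=> /= _ [_ [a ->] <-]; rewrite preimage_itvoy.
have mray (h : T -> R) c : measurable_fun D h ->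
    measurable (D `&` [set x | c < h x]).
  by move=> mh; rewrite -preimage_itvoy; apply: mh => //; exact: measurable_itv.
rewrite [X in measurable X](_ : _ = (D `&` [set x | a < g x 0]) `|`
  \bigcup_(q : rat) if 0 <= q :> rat then
    (D `&` [set x | ratr q < f x]) `&` (D `&` [set x | a < g x (ratr q)])
  else set0); last first.
  rewrite predeqE => x; split=> [[Dx /= agx]|].
    have := f0 x Dx; rewrite le_eqVlt => /predU1P[fx0|fx0].
      by left; split => //=; rewrite fx0.
    right.
    have /nbhs_ballP[e /= e0 He] : \forall y \near f x, a < g x y.
      exact: cvgr_gt (cg x Dx _ fx0) _ agx.
    have : Num.max 0 (f x - e) < f x by rewrite gt_max fx0 gtrBl.
    move=> /rat_in_itvoo[q]; rewrite in_itv/= gt_max => /andP[/andP[q0 qe] qf].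
    exists q => //; rewrite -(ler0q R) (ltW q0); split; split => //=.
    by apply: He; rewrite /ball/= gtr0_norm ?subr_gt0// ltrBlDr -ltrBlDl.
  move=> [[Dx /= agx]|[q _]].
    by split => //=; apply: lt_le_trans agx _; apply: ndg => //; exact: f0.
  case: ifPn => // q0 [[Dx /= qf] [_ /= agx]]; split => //=.
  by apply: lt_le_trans agx _; apply: ndg; rewrite ?ler0q ?(ltW qf).
apply: measurableU; first by apply: mray; exact: mg.
apply: bigcupT_measurable_rat => q; case: ifPn => // q0.
by apply: measurableI; apply: mray => //; apply: mg; rewrite ler0q.
Qed.

(** If weights u k increase within [0, 1] and lose no mass of p in the limit,
    then they tend to 1 wherever p > 0, up to a null set. *)
Lemma ae_cvg1_integral (d : measure_display) (T : measurableType d)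
    (R : realType) (mu : {measure set T -> \bar R}) (D : set T) (p : T -> R)
    (u : nat -> T -> R) :
  measurable D -> (forall x, D x -> 0 < p x) -> mu.-integrable D (EFin \o p) ->
  (forall k, measurable_fun D (u k)) ->
  (forall k x, D x -> 0 <= u k x <= 1) ->
  (forall x, D x -> nondecreasing_seq (u ^~ x)) ->
  (\int[mu]_(x in D) (u k x * p x)%:E @[k --> \oo] -->
     \int[mu]_(x in D) (p x)%:E)%E ->
  {ae mu, forall x, D x -> u k x @[k --> \oo] --> (1 : R)}.
Proof.
move=> mD p0 ip mu_ u01 ndu cvg1.
pose L x := sup (range (u ^~ x)).
have mp : measurable_fun D p by apply/measurable_EFinP; exact: measurable_int ip.
have uL x : D x -> u k x @[k --> \oo] --> L x.
  move=> Dx; apply: nondecreasing_cvgn; first exact: ndu.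
  by exists 1 => _ [k _ <-]; case/andP: (u01 k x Dx).
have mL : measurable_fun D L by exact: (measurable_fun_cvg mu_ uL).
have L01 x : D x -> 0 <= L x <= 1.
  move=> Dx; apply/andP; split.
    by apply: (cvgr_to_ge (uL x Dx)); apply: nearW => k; case/andP: (u01 k x Dx).
  by apply: (cvgr_to_le (uL x Dx)); apply: nearW => k; case/andP: (u01 k x Dx).
have pge0 x : D x -> 0 <= p x by move=> Dx; exact/ltW/p0.
have cvgL : (\int[mu]_(x in D) (u k x * p x)%:E @[k --> \oo] -->
     \int[mu]_(x in D) (L x * p x)%:E)%E.
  apply: (@dominated_cvg _ _ _ _ _ mD (fun k x => (u k x * p x)%:E)
    (fun x => (L x * p x)%:E) (EFin \o p)) => //.
  - by move=> k; apply/measurable_EFinP; exact: measurable_funM.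
  - move=> x Dx; apply: cvg_EFin; first exact: nearW.
    by apply: cvgMr_tmp; exact: uL.
  - move=> k x Dx /=; have /andP[u0 u1] := u01 k x Dx.
    by rewrite lee_fin ger0_norm ?mulr_ge0 ?pge0// ler_piMl ?pge0.
have iLp : mu.-integrable D (EFin \o (fun x => L x * p x)).
  apply: (le_integrable mD _ _ ip).
    by apply/measurable_EFinP; exact: measurable_funM.
  move=> x Dx /=; have /andP[L0 L1] := L01 x Dx.
  by rewrite lee_fin !ger0_norm ?mulr_ge0 ?pge0// ler_piMl ?pge0.
have int0 : (\int[mu]_(x in D) `|(p x)%:E - (L x * p x)%:E| = 0)%E.
  under eq_integral => x /set_mem Dx.
    have /andP[L0 L1] := L01 x Dx.
    rewrite gee0_abs; last by rewrite -EFinB lee_fin subr_ge0 ler_piMl ?pge0.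
    over.
  rewrite integralB_EFin//.
  have -> : (\int[mu]_(x in D) (L x * p x)%:E = \int[mu]_(x in D) (p x)%:E)%E.
    exact: (cvg_unique _ cvgL cvg1).
  by rewrite subee//; exact: integrable_fin_num.
have mdiff : measurable_fun D (fun x => (p x)%:E - (L x * p x)%:E)%E.
  apply: emeasurable_funB; apply/measurable_EFinP => //.
  exact: measurable_funM.
have /(ae_eq_integral_abs mu mD mdiff) := int0.
apply: filterS => x /= + Dx => /(_ Dx) /eqP.
rewrite -EFinB eqe subr_eq0 -{1}(mul1r (p x)) => /eqP.
move=> /(mulIf (lt0r_neq0 (p0 x Dx))) ->; exact: uL.
Qed.


Lemma cvg_pinfty_nondecreasing (R : realType) (u : R -> R) (l : R) :
  (forall s t, 0 <= s -> s <= t -> u s <= u t) -> (forall t, 0 <= t -> u t <= l) ->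
  u k%:R @[k --> \oo] --> l -> u t @[t --> +oo] --> l.
Proof.
move=> ndu ul ucvg; apply/cvgrPdist_lt => e e0.
have /cvgrPdist_lt/(_ e e0)[k _ /(_ k (leqnn _))] := ucvg.
rewrite /= => uk; near=> t.
have kt : k%:R <= t by near: t; exact: nbhs_pinfty_ge.
have t0 : 0 <= t by exact: le_trans kt.
rewrite ger0_norm ?subr_ge0 ?ul//; apply: le_lt_trans uk.
rewrite ger0_norm ?subr_ge0 ?ul//.
by rewrite lerD2l lerN2 ndu.
Unshelve. all: by end_near. Qed.

(** * Detection functions *)

Section search.
Context (R : realType) (n : nat).
Implicit Types (X : set (euclidean R n)) (pi : euclidean R n -> R).
Implicit Types (d : euclidean R n -> R -> R) (E : R -> R).
Local Notation mu := (lebesgue_n R n).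

(** At the endpoint y = 0 no derivative is needed: d x 0 = 0 is the least value
    of d. *)
Lemma detection_nondecreasing X d : detection_function X d -> regular X d ->
  forall x, X x -> forall y z, 0 <= y -> y <= z -> d x y <= d x z.
Proof.
move=> dd rd x Xx y z; have [d0 [d' [dd' _ d'0 _]]] := rd x Xx.
have der t : 0 < t -> derivable (d x) t 1 /\ (d x)^`()%classic t = d' t.
  by move=> t0; apply: is_derive_ge0_derivable => //; apply: dd'; exact: ltW.
rewrite le_eqVlt => /predU1P[<- z0|y0 yz].
  by rewrite d0; case: (dd z z0) => _ /(_ x Xx) /andP[].
have pos t : t \in `]y, +oo[ -> 0 < t.
  by rewrite in_itv/= andbT; exact: lt_trans.
apply: (@ger0_derive1_ndecry _ (d x) y) => //.
- by move=> t /pos /der[].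
- by move=> t /pos t0; rewrite (der _ t0).2 ltW// d'0// ltW.
- apply: derivable_within_continuous => t; rewrite in_itv/= andbT => yt.
  by apply: (der t _).1; exact: lt_le_trans yt.
Qed.

Lemma detection_continuous X d : regular X d ->
  forall x, X x -> forall y, 0 < y -> {for y, continuous (d x)}.
Proof.
move=> rd x Xx y y0; have [_ [d' [dd' _ _ _]]] := rd x Xx.
have [/derivable1_diffP dy _] := is_derive_ge0_derivable y0 (dd' y (ltW y0)).
exact: differentiable_continuous.
Qed.

Lemma measurable_detection X d f : detection_function X d -> regular X d ->
  allocation X f -> measurable_fun X (fun x => d x (f x)).
Proof.
move=> dd rd [mf f0]; apply: measurable_fun_comp_nondecreasing => //.
- by move=> y /dd[].
- exact: detection_nondecreasing.
- exact: detection_continuous.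
Qed.

(** * The target density and proportional allocations *)

Section density.
Variable pi : euclidean R n -> R.
Hypothesis tpi : target_density pi.
Let X := possibility_area pi.

Lemma measurable_possibility_area : measurable X.
Proof.
have [mpi _ _] := tpi.
rewrite (_ : X = setT `&` [set x | 0 < pi x]); last by rewrite setTI.
by rewrite -preimage_itvoy; apply: mpi => //; exact: measurable_itv.
Qed.

Lemma measurable_density : measurable_fun X pi.
Proof. by have [mpi _ _] := tpi; exact: measurable_funTS. Qed.

Lemma integral_possibility_area : (\int[mu]_(x in X) (pi x)%:E = 1)%E.
Proof.
have [_ pi0 <-] := tpi; rewrite integral_mkcond; apply: eq_integral => x _.
rewrite patchE; case: ifPn => // /negP xX; apply/eqP; rewrite eqe eq_le pi0 /=.
by rewrite leNgt; apply/negP => pix; apply: xX; rewrite inE.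
Qed.

Lemma integrable_density : mu.-integrable X (EFin \o pi).
Proof.
have [mpi pi0 _] := tpi.
apply/integrableP; split; first by apply/measurable_EFinP; exact: measurable_density.
under eq_integral do rewrite /= ger0_norm//.
by rewrite integral_possibility_area ltry.
Qed.

Lemma cost_proportional c : 0 <= c -> cost X (fun x => c * pi x) = c%:E.
Proof.
move=> c0; rewrite /cost; under eq_integral do rewrite EFinM.
rewrite ge0_integralZl_EFin//.
- by rewrite integral_possibility_area mule1.
- exact: measurable_possibility_area.
- by move=> x Xx; rewrite lee_fin ltW.
- by apply/measurable_EFinP; exact: measurable_density.
Qed.

(** The competitor: effort spread at every time in proportion to the density. *)
Lemma proportional_plan E : cumulative_effort E ->
  plan_class X E (fun x t => E t * pi x).
Proof.
move=> [E0 ndE _]; split; last by move=> t /E0; exact: cost_proportional.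
split=> [t t0|x Xx s t s0 st].
  split; first by apply: measurable_funM => //; exact: measurable_density.
  by move=> x Xx; rewrite mulr_ge0 ?E0// ltW.
by rewrite ler_wpM2r ?ndE// ltW.
Qed.

Variable d : euclidean R n -> R -> R.
Hypotheses (dd : detection_function X d) (rd : regular X d).
Hypothesis d1 : forall x, X x -> d x y @[y --> +oo] --> (1 : R).

Lemma detection_prob_le1 f : allocation X f ->
  (detection_prob X d pi f <= 1)%E.
Proof.
move=> af; have [_ f0] := af.
rewrite -integral_possibility_area; apply: ge0_le_integral => //.
- exact: measurable_possibility_area.
- move=> x Xx; have [_ /(_ x Xx)/andP[h0 _]] := dd (f0 x Xx).
  by rewrite lee_fin mulr_ge0// ltW.
- apply/measurable_EFinP; apply: measurable_funM; last exact: measurable_density.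
  exact: measurable_detection.
- by apply/measurable_EFinP; exact: measurable_density.
- move=> x Xx; have [_ /(_ x Xx)/andP[_ h1]] := dd (f0 x Xx).
  by rewrite lee_fin ler_piMl// ltW.
Qed.

Lemma detection_prob_proportional (c : nat -> R) : (forall k, 0 <= c k) ->
  c k @[k --> \oo] --> +oo ->
  (detection_prob X d pi (fun x => (c k * pi x)%R) @[k --> \oo] --> 1)%E.
Proof.
move=> c0 coo; rewrite -integral_possibility_area.
have ac k : allocation X (fun x => c k * pi x).
  split; first by apply: measurable_funM => //; exact: measurable_density.
  by move=> x Xx; rewrite mulr_ge0// ltW.
apply: (@dominated_cvg _ _ _ _ _ measurable_possibility_area
  (fun k x => (d x (c k * pi x) * pi x)%:E)
  (EFin \o pi) (EFin \o pi)) => //.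
- move=> k; apply/measurable_EFinP; apply: measurable_funM.
    exact: (measurable_detection dd rd (ac k)).
  exact: measurable_density.
- move=> x Xx; apply: cvg_EFin; first exact: nearW.
  rewrite -[X in _ --> X]mul1r; apply: cvgMr_tmp.
  move/cvg_pinftyP : (d1 Xx); apply.
  apply/cvgryPge => A; have /cvgryPge/(_ (A / pi x)) := coo.
  by apply: filterS => k; rewrite ler_pdivrMr.
- exact: integrable_density.
- move=> k x Xx /=; have [_ /(_ x Xx)/andP[h0 h1]] := dd ((ac k).2 x Xx).
  have pi0 : 0 <= pi x by exact: ltW.
  by rewrite lee_fin ger0_norm ?mulr_ge0// ler_piMl.
Qed.

(** * Convergence of the true detection probability *)

Variable E : R -> R.
Hypotheses (hE : cumulative_effort E) (Eoo : E t @[t --> +oo] --> +oo).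
Variable phi : euclidean R n -> R -> R.

Lemma ae_true_detection_cvg : uniformly_optimal X d pi E phi ->
  {ae mu, forall x0, X x0 ->
    true_detection_prob d x0 (phi ^~ t) @[t --> +oo] --> (1 : R)}.
Proof.
move=> [[[aphi ndphi] costphi] opt]; have [E0 _ _] := hE.
pose u (k : nat) x := d x (phi x k%:R).
have cvg1 : (\int[mu]_(x in X) (u k x * pi x)%:E @[k --> \oo] -->
     \int[mu]_(x in X) (pi x)%:E)%E.
  rewrite integral_possibility_area.
  apply: (@squeeze_cvge _ _ _ _
    (fun k => detection_prob X d pi (fun x => E k%:R * pi x)) _ (cst 1%E)).
  - apply: nearW => k; apply/andP; split; last exact: (detection_prob_le1 (aphi _ _)).
    by apply: (opt _ _ (fun x t => E t * pi x)) => //; exact: proportional_plan.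
  - apply: detection_prob_proportional; first by move=> k; exact: E0.
    by apply: cvg_comp Eoo; exact: cvgr_idn.
  - exact: cvg_cst.
have : {ae mu, forall x, X x -> u k x @[k --> \oo] --> (1 : R)}.
  apply: (ae_cvg1_integral measurable_possibility_area _ integrable_density
    _ _ _ cvg1) => //.
  - by move=> k; apply: measurable_detection => //; exact: aphi.
  - by move=> k x Xx; apply: (dd _).2 => //; exact: (aphi _ _).2.
  - move=> x Xx j k jk; apply: (detection_nondecreasing dd rd) => //.
      exact: (aphi _ _).2.
    by apply: ndphi => //; rewrite ler_nat.
apply: filterS => x + Xx => /(_ Xx) ux.
apply: cvg_pinfty_nondecreasing ux.
- move=> s t s0 st; apply: (detection_nondecreasing dd rd) => //.
    exact: (aphi _ _).2.
  exact: ndphi.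
- by move=> t t0; have [_ /(_ x Xx)/andP[]] := dd ((aphi t t0).2 x Xx).
Qed.

(** The term - lambda y would be unbounded above if lambda were negative. *)
Lemma multiplier_ge0 t lambda x : X x ->
  (forall y, 0 <= y ->
    d x y * pi x - lambda * y <= d x (phi x t) * pi x - lambda * phi x t) ->
  0 <= lambda.
Proof.
move=> Xx; pose c := d x (phi x t) * pi x - lambda * phi x t => hl.
rewrite leNgt; apply/negP => l0.
have pi0 : 0 <= pi x by exact: ltW.
(* With a negative multiplier, this y gains -lambda y = |c| + 1, more than the
   maximum c allows. *)
pose y := (`|c| + 1) / - lambda.
have y0 : 0 <= y by rewrite divr_ge0// ?addr_ge0// oppr_ge0 ltW.
have := hl y y0; apply/negP; rewrite -ltNge -/c.
have ly : - lambda * y = `|c| + 1.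
  by rewrite /y mulrCA divff ?mulr1// oppr_eq0 lt_eqF.
rewrite -[X in _ < _ + X]mulNr ly.
have [_ /(_ x Xx)/andP[h0 _]] := dd y0.
apply: (@lt_le_trans _ _ (`|c| + 1)).
  by rewrite (le_lt_trans (ler_norm c))// ltrDl.
by rewrite lerDr mulr_ge0.
Qed.

(** Integrating over X the comparison of phi(x,t) with zero effort. *)
Lemma multiplier_le t lambda : 0 < t -> plan_class X E phi ->
  (forall x, X x -> forall y, 0 <= y ->
    d x y * pi x - lambda * y <= d x (phi x t) * pi x - lambda * phi x t) ->
  0 <= lambda -> lambda * E t <= 1.
Proof.
move=> t0 [[aphi _] costphi] hl l0; have t0' := ltW t0.
have [mphi phi0] := aphi t t0'.
rewrite -lee_fin EFinM -(costphi t t0') /cost.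
rewrite -ge0_integralZl_EFin//; last 2 first.
- exact: measurable_possibility_area.
- exact/measurable_EFinP.
rewrite -integral_possibility_area; apply: ge0_le_integral.
- exact: measurable_possibility_area.
- by move=> x Xx; rewrite -EFinM lee_fin mulr_ge0// phi0.
- apply/measurable_EFinP; exact: measurable_funM.
- by apply/measurable_EFinP; exact: measurable_density.
move=> x Xx; rewrite -EFinM lee_fin.
have := hl x Xx 0 (lexx _); rewrite (rd Xx).1 mul0r mulr0 subr0 subr_ge0.
move=> /le_trans; apply.
have [_ /(_ x Xx)/andP[_ h1]] := dd (phi0 x Xx).
by rewrite ler_piMl// ltW.
Qed.

Lemma true_detection_cvg : plan_class X E phi ->
  pointwise_representative X d pi phi -> forall x0, X x0 ->
  true_detection_prob d x0 (phi ^~ t) @[t --> +oo] --> (1 : R).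
Proof.
move=> pphi prep x Xx; have [[aphi _] _] := pphi; have [_ _ Epos] := hE.
apply/cvgrPdist_lt => e e0.
have e20 : 0 < e / 2 by rewrite divr_gt0.
have [y y0 dy] : exists2 y, 0 <= y & 1 - e / 2 < d x y.
  have : \forall y \near +oo, 0 <= y /\ 1 - e / 2 < d x y.
    near=> y; split; first by near: y; exact: nbhs_pinfty_ge.
    by near: y; apply: (cvgr_gt _ (d1 Xx)); rewrite gtrBl.
  by move=> /filter_ex[y [y0 dy]]; exists y.
have pi0 : 0 < pi x by [].
near=> t.
have t0 : 0 < t by near: t; exact: nbhs_pinfty_gt.
have [l hl] := prep t t0.
have l0 := multiplier_ge0 Xx (hl x Xx).
have lE := multiplier_le t0 pphi hl l0.
have phi0 := (aphi t (ltW t0)).2 x Xx.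
have [_ /(_ x Xx)/andP[_ h1]] := dd phi0.
rewrite /true_detection_prob ger0_norm ?subr_ge0//.
(* Since lambda <= 1 / E t, this makes lambda * y at most e / 2 * pi x. *)
have Ebig : y / (e / 2 * pi x) <= E t.
  by near: t; move/cvgryPge : Eoo; exact.
have ly : l * y <= e / 2 * pi x.
  move: Ebig; rewrite ler_pdivrMr ?mulr_gt0// => Ebig.
  apply: (le_trans (ler_wpM2l l0 Ebig)); rewrite mulrA ler_piMl//.
  by rewrite mulr_ge0 ?ltW.
have : d x y - e / 2 <= d x (phi x t).
  rewrite -(ler_pM2r pi0) mulrBl.
  apply: (@le_trans _ _ (d x y * pi x - l * y)); first by rewrite lerD2l lerN2.
  apply: (le_trans (hl x Xx y y0)).
  by rewrite gerBl mulr_ge0.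
rewrite ltrBlDr -ltrBlDl; apply: lt_le_trans.
by rewrite ltrBrDr {1}(splitr e) opprD addrA subrK.
Unshelve. all: by end_near. Qed.

End density.
End search.

Unset Implicit Arguments.
Set Strict Implicit.

Theorem theorem6p1 (R : realType) (n : nat) (n_gt0 : (0 < n)%N)
    (pi : euclidean R n -> R) (d : euclidean R n -> R -> R) (E : R -> R)
    (phi : euclidean R n -> R -> R) :
  let X := possibility_area pi in
  target_density pi ->
  detection_function X d ->
  regular X d ->
  (forall x, X x -> d x y @[y --> +oo] --> (1 : R)) ->
  cumulative_effort E ->
  E t @[t --> +oo] --> +oo ->
  uniformly_optimal X d pi E phi ->
  {ae lebesgue_n R n, forall x0, X x0 ->
    true_detection_prob d x0 (phi ^~ t) @[t --> +oo] --> (1 : R)} /\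
  (pointwise_representative X d pi phi ->
    forall x0, X x0 ->
      true_detection_prob d x0 (phi ^~ t) @[t --> +oo] --> (1 : R)).
Proof.
move=> X tpi dd rd d1 hE Eoo opt; split.
  exact: (ae_true_detection_cvg tpi dd rd d1 hE Eoo opt).
exact: (true_detection_cvg tpi dd rd d1 hE Eoo opt.1).
Qed.
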